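(* Let $\lambda>0$ and let $\bar\zeta=(\bar x,\bar y,\bar z,\bar u,\bar v,\bar w)$ satisfy the stationarity system with parameter $\lambda$, with $S(\bar x)=\{\bar y\}=\{\bar z\}$. Suppose that $\{i\mid\bar u_i=0,\ G_i(\bar x,\bar y)=0\}=\emptyset$ and $\{j\mid\bar v_j=0,\ g_j(\bar x,\bar y)=0\}=\emptyset$ (strict complementarity). Suppose that the lower-level problem is convex at $\bar x$ (i.e. $f(\bar x,\cdot)$ and $g_j(\bar x,\cdot)$, $j=1,\dots,q$, are convex), and that: (a) $K$ is uniformly compact near $\bar x$ (there is a neighborhood $U$ of $\bar x$ such that the closure of $\bigcup_{x\in U}K(x)$ is compact) and $K(\bar x)\ne\emptyset$; (b) (LLICQ) the family $\{\nabla_2g_j(\bar x,\bar y): g_j(\bar x,\bar y)=0\}$ is linearly independent; (c) $e^\top\nabla_2^2\ell(\bar x,\bar y,\bar w)e>0$ for all $e\in\mathbb{R}^m\setminus\{0\}$ such that $\nabla_2g_j(\bar x,\bar y)^\top e=0$ for $j\in\nu^3$ and $\nabla_2g_j(\bar x,\bar y)^\top e\le0$ for $j\in\theta^3$; (d) (ULICQ at $(\bar x,\bar y)$) the family $\{\nabla G_i(\bar x,\bar y): G_i(\bar x,\bar y)=0\}\cup\{\nabla g_j(\bar x,\bar y): g_j(\bar x,\bar y)=0\}$ of vectors in $\mathbb{R}^{n+m}$ is linearly independent; (e) for all $d\in C(\bar x,\bar y)\setminus\{0\}$, $$(d^{1,2})^\top\nabla^2\mathcal{L}^\lambda(\bar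 x,\bar y,\bar u,\bar v)\,d^{1,2}>\lambda\,(d^{1,3})^\top\nabla^2\ell(\bar x,\bar y,\bar w)\,d^{1,3}.$$ Then $(\bar x,\bar y)$ is a strict local optimal solution of $$\min_{x,y}\ F(x,y)+\lambda\big(f(x,y)-\varphi(x)\big)\quad\text{s.t.}\quad G(x,y)\le0,\ g(x,y)\le0.$$
   Context: The functions $F,f:\mathbb{R}^n\times\mathbb{R}^m\to\mathbb{R}$, $G:\mathbb{R}^n\times\mathbb{R}^m\to\mathbb{R}^p$ and $g:\mathbb{R}^n\times\mathbb{R}^m\to\mathbb{R}^q$ are twice continuously differentiable. $\nabla_1,\nabla_2$ denote gradients with respect to the first (in $\mathbb{R}^n$) and second (in $\mathbb{R}^m$) variable; $\nabla$ the gradient with respect to both; $\nabla_2^2$ the Hessian with respect to the second variable. $K(x):=\{z\in\mathbb{R}^m\mid g(x,z)\le0\}$; $S(x):=\operatorname{argmin}_z\{f(x,z)\mid z\in K(x)\}$ is assumed nonempty for all $x\in\mathbb{R}^n$; $\varphi(x):=\min_z\{f(x,z)\mid z\in K(x)\}$. Define $\ell(x,z,w):=f(x,z)+w^\top g(x,z)$ and $\mathcal{L}^\lambda(x,y,u,v):=F(x,y)+u^\top G(x,y)+v^\top g(x,y)+\lambda f(x,y)$; $\nabla^2\mathcal{L}^\lambda$ and $\nabla^2\ell$ are the Hessians with respect to the first two variables, $(x,y)$ and $(x,z)$ respectively. Stationarity system with parameter $\lambda$ (for $(x,y,z,u,v,w)\in\mathbb{R}^n\times\mathbb{R}^m\times\mathbb{R}^m\times\mathbb{R}^p\times\mathbb{R}^q\times\mathbb{R}^q$):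 $\nabla_1\mathcal{L}^\lambda(x,y,u,v)-\lambda\nabla_1\ell(x,z,w)=0$; $\nabla_2\mathcal{L}^\lambda(x,y,u,v)=0$; $\nabla_2\ell(x,z,w)=0$; $u\ge0$, $G(x,y)\le0$, $u^\top G(x,y)=0$; $v\ge0$, $g(x,y)\le0$, $v^\top g(x,y)=0$; $w\ge0$, $g(x,z)\le0$, $w^\top g(x,z)=0$. Index sets (recall $\bar z=\bar y$): $\nu^1:=\{i\mid\bar u_i>0,\,G_i(\bar x,\bar y)=0\}$, $\nu^2:=\{j\mid\bar v_j>0,\,g_j(\bar x,\bar y)=0\}$, $\nu^3:=\{j\mid\bar w_j>0,\,g_j(\bar x,\bar y)=0\}$, $\theta^3:=\{j\mid\bar w_j=0,\,g_j(\bar x,\bar y)=0\}$. For $d=(d^1,d^2,d^3)\in\mathbb{R}^n\times\mathbb{R}^m\times\mathbb{R}^m$ write $d^{1,2}:=(d^1,d^2)$, $d^{1,3}:=(d^1,d^3)$, and $$C(\bar x,\bar y):=\{d\mid\nabla G_i(\bar x,\bar y)^\top d^{1,2}=0\ (i\in\nu^1),\ \nabla g_j(\bar x,\bar y)^\top d^{1,2}=0\ (j\in\nu^2),\ \nabla g_j(\bar x,\bar y)^\top d^{1,3}=0\ (j\in\nu^3)\}.$$ *)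

(* Defs.v *)
From mathcomp Require Import all_boot all_order all_algebra.
From mathcomp Require Import all_classical all_reals all_analysis.

Set Implicit Arguments.
Unset Strict Implicit.
Unset Printing Implicit Defensive.

Import Order.TTheory GRing.Theory Num.Theory.
Import numFieldNormedType.Exports.

Local Open Scope classical_set_scope.
Local Open Scope ring_scope.

(* Vectors of R^k are row vectors. *)

Section Calculus.
Context {R : realType}.

Definition dot k (u v : 'rV[R]_k) : R := (u *m v^T) 0 0.

Definition quad k (H : 'M[R]_k) (d : 'rV[R]_k) : R := (d *m H *m d^T) 0 0.

Definition grad k (h : 'rV[R]_k -> R) (a : 'rV[R]_k) : 'rV[R]_k :=
  \row_i 'D_(delta_mx 0 i) h a.

Definition hess k (h : 'rV[R]_k -> R) (a : 'rV[R]_k) : 'M[R]_k :=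
  'J (grad h) a.

(* [continuous (hess h)] alone says nothing about differentiability, since
   ['D_v] and ['J] are total operators. *)
Definition C2 k (h : 'rV[R]_k -> R) : Prop :=
  [/\ forall a, differentiable h a,
      forall a, differentiable (grad h) a
    & continuous (hess h)].

(* A function of (x, y) seen as a function on R^(n + m); the joint gradient and
   Hessian of h at (x, y) are those of [joint h] at [row_mx x y], the partial
   ones are those of [h^~ y] at x and of [h x] at y. *)
Definition joint n m (T : Type) (h : 'rV[R]_n -> 'rV[R]_m -> T)
  (s : 'rV[R]_(n + m)) : T := h (lsubmx s) (rsubmx s).

Definition component n m k (h : 'rV[R]_n -> 'rV[R]_m -> 'rV[R]_k) (i : 'I_k) :
  'rV[R]_n -> 'rV[R]_m -> R := fun x y => h x y 0 i.

Definition jgrad n m (h : 'rV[R]_n -> 'rV[R]_m -> R) x y : 'rV[R]_(n + m) :=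
  grad (joint h) (row_mx x y).

Definition jhess n m (h : 'rV[R]_n -> 'rV[R]_m -> R) x y : 'M[R]_(n + m) :=
  hess (joint h) (row_mx x y).

Definition nonpos k (s : 'rV[R]_k) : Prop := forall i, s 0 i <= 0.

(* u >= 0, s <= 0, u^T s = 0 *)
Definition complementary k (u s : 'rV[R]_k) : Prop :=
  [/\ forall i, 0 <= u 0 i, nonpos s & dot u s = 0].

(* With u a multiplier and s the constraint values, these are the index sets
   called nu and theta. *)
Definition nu k (u s : 'rV[R]_k) : set 'I_k := [set i | 0 < u 0 i /\ s 0 i = 0].
Definition theta k (u s : 'rV[R]_k) : set 'I_k :=
  [set i | u 0 i = 0 /\ s 0 i = 0].

Definition active k (s : 'rV[R]_k) : seq 'I_k :=
  [seq i <- enum 'I_k | s 0 i == 0].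

Definition strict_local_solution (T : topologicalType) (D : set T) (h : T -> R)
    (a : T) : Prop :=
  D a /\ \forall b \near a, D b -> b <> a -> h a < h b.

End Calculus.

Section Bilevel.
Context {R : realType} {n m p q : nat}.
Variables (F f : 'rV[R]_n -> 'rV[R]_m -> R).
Variables (G : 'rV[R]_n -> 'rV[R]_m -> 'rV[R]_p).
Variables (g : 'rV[R]_n -> 'rV[R]_m -> 'rV[R]_q).

Definition lower_feasible (x : 'rV[R]_n) : set 'rV[R]_m :=
  [set z | nonpos (g x z)].

Definition lower_argmin (x : 'rV[R]_n) : set 'rV[R]_m :=
  [set z | lower_feasible x z /\
           forall z', lower_feasible x z' -> f x z <= f x z'].

(* The infimum is attained, hence a minimum, as soon as [lower_argmin x] is
   nonempty; otherwise its value is not meaningful. *)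
Definition lower_value (x : 'rV[R]_n) : R := inf (f x @` lower_feasible x).

Definition lower_lagrangian (w : 'rV[R]_q) (x : 'rV[R]_n) (z : 'rV[R]_m) : R :=
  f x z + dot w (g x z).

Definition lagrangian (lam : R) (u : 'rV[R]_p) (v : 'rV[R]_q)
    (x : 'rV[R]_n) (y : 'rV[R]_m) : R :=
  F x y + dot u (G x y) + dot v (g x y) + lam * f x y.

Definition stationary (lam : R) (x : 'rV[R]_n) (y z : 'rV[R]_m)
    (u : 'rV[R]_p) (v w : 'rV[R]_q) : Prop :=
  [/\ grad ((lagrangian lam u v)^~ y) x
        - lam *: grad ((lower_lagrangian w)^~ z) x = 0,
      grad (lagrangian lam u v x) y = 0
    & grad (lower_lagrangian w x) z = 0] /\
  [/\ complementary u (G x y),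
      complementary v (g x y)
    & complementary w (g x z)].

Definition critical_cone (x : 'rV[R]_n) (y : 'rV[R]_m)
    (u : 'rV[R]_p) (v w : 'rV[R]_q) : set ('rV[R]_n * 'rV[R]_m * 'rV[R]_m) :=
  [set d | let: (d1, d2, d3) := d in
    [/\ forall i, nu u (G x y) i ->
          dot (jgrad (component G i) x y) (row_mx d1 d2) = 0,
        forall j, nu v (g x y) j ->
          dot (jgrad (component g j) x y) (row_mx d1 d2) = 0
      & forall j, nu w (g x y) j ->
          dot (jgrad (component g j) x y) (row_mx d1 d3) = 0]].

Definition uniformly_compact_near (x : 'rV[R]_n) : Prop :=
  exists2 U : set 'rV[R]_n,
    nbhs x U & compact (closure (\bigcup_(x' in U) lower_feasible x')).

Definition LLICQ (x : 'rV[R]_n) (y : 'rV[R]_m) : Prop :=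
  free [seq grad (component g j x) y | j <- active (g x y)].

Definition ULICQ (x : 'rV[R]_n) (y : 'rV[R]_m) : Prop :=
  free ([seq jgrad (component G i) x y | i <- active (G x y)]
        ++ [seq jgrad (component g j) x y | j <- active (g x y)]).

Definition upper_feasible : set ('rV[R]_n * 'rV[R]_m) :=
  [set s | nonpos (G s.1 s.2) /\ nonpos (g s.1 s.2)].

Definition penalized (lam : R) (s : 'rV[R]_n * 'rV[R]_m) : R :=
  F s.1 s.2 + lam * (f s.1 s.2 - lower_value s.1).

End Bilevel.

(* Main.v *)
(** Let [Delta] be the increment of the upper Lagrangian minus [lam] times that
of the lower one, along a displacement [d = (x - xb, y - yb, z - yb)].
Stationarity cancels its linear part, so [Delta] is half of the quadratic form
of the second-order condition up to [o(|d|^2)].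

By LLICQ, every x close to xb admits a point z close to yb at which all the
constraints active at [(xb, yb)] remain active; hence the optimal value at x is
at most [f x z], the lower Lagrangian at [(x, z)].  If a feasible [(x, y)] had
penalized value at most that of [(xb, yb)], this would give
[Delta <= u.G(x, y) + v.g(x, y) <= 0].  By compactness of the unit sphere, either
the quadratic form is at least [c |d|^2], which contradicts [Delta <= 0], or the
gradient of some constraint, weighted by its multiplier, is at least [c |d|]
along [d]; this is impossible since the weighted constraint value is bounded by
[|Delta| = o(|d|)]. *)
From HB Require Import structures.
Require Import Defs.
From mathcomp Require Import all_boot all_order all_algebra.
From mathcomp Require Import all_classical all_reals all_analysis.
From mathcomp Require Import ring lra.

Set Implicit Arguments.
Unset Strict Implicit.
Unset Printing Implicit Defensive.

Import Order.TTheory GRing.Theory Num.Theory.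
Import numFieldNormedType.Exports.

Local Open Scope classical_set_scope.
Local Open Scope ring_scope.

(** * Max norm, dot product and quadratic forms on row vectors *)

Section RowVectors.
Context {R : realType}.

Lemma coord_norm_le k (v : 'rV[R]_k) i : `|v 0 i| <= `|v|.
Proof.
rewrite [leRHS]/Num.norm/= mx_normrE.
exact: (le_bigmax _ (fun ij : 'I_1 * 'I_k => `|v ij.1 ij.2|) (0, i)).
Qed.

Lemma rV_norm_le k (v : 'rV[R]_k) r :
  0 <= r -> (forall i, `|v 0 i| <= r) -> `|v| <= r.
Proof.
move=> r0 vr; rewrite [leLHS]/Num.norm/= mx_normrE (bigmax_le _ r0)//= => -[i j] _.
by rewrite ord1.
Qed.

Lemma row_mx_norm_le n m (u : 'rV[R]_n) (v : 'rV[R]_m) r :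
  `|u| <= r -> `|v| <= r -> `|row_mx u v| <= r.
Proof.
move=> ur vr; apply: rV_norm_le => [|i]; first exact: le_trans ur.
by rewrite mxE; case: (fintype.split i) => j; apply: le_trans (coord_norm_le _ _) _.
Qed.

Lemma lsubmx_norm_le n m (s : 'rV[R]_(n + m)) : `|lsubmx s| <= `|s|.
Proof. by apply: rV_norm_le => // i; rewrite mxE coord_norm_le. Qed.

Lemma rsubmx_norm_le n m (s : 'rV[R]_(n + m)) : `|rsubmx s| <= `|s|.
Proof. by apply: rV_norm_le => // i; rewrite mxE coord_norm_le. Qed.

Lemma dotE k (u v : 'rV[R]_k) : dot u v = \sum_i u 0 i * v 0 i.
Proof. by rewrite /dot mxE; apply: eq_bigr => i _; rewrite mxE. Qed.

(** The norm of a matrix is the largest absolute value of its entries, so a factor [k] replaces the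
    Cauchy-Schwarz inequality. *)
Lemma dot_norm_le k (u v : 'rV[R]_k) : `|dot u v| <= k%:R * (`|u| * `|v|).
Proof.
rewrite dotE (le_trans (ler_norm_sum _ _ _))//.
rewrite -[k in k%:R]card_ord mulr_natl -sumr_const ler_sum// => i _.
by rewrite normrM ler_pM// coord_norm_le.
Qed.

Lemma dotBl k (u v w : 'rV[R]_k) : dot (u - v) w = dot u w - dot v w.
Proof. by rewrite /dot mulmxBl !mxE. Qed.

Lemma dotZl k (u w : 'rV[R]_k) c : dot (c *: u) w = c * dot u w.
Proof. by rewrite /dot -scalemxAl !mxE. Qed.

Lemma dotZr k (u w : 'rV[R]_k) c : dot u (c *: w) = c * dot u w.
Proof. by rewrite /dot linearZ/= -scalemxAr !mxE. Qed.

Lemma dot_row_mx n m (u u' : 'rV[R]_n) (v v' : 'rV[R]_m) :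
  dot (row_mx u v) (row_mx u' v') = dot u u' + dot v v'.
Proof. by rewrite /dot tr_row_mx mul_row_col !mxE. Qed.

Lemma dot0l k (w : 'rV[R]_k) : dot 0 w = 0.
Proof. by rewrite /dot mul0mx mxE. Qed.

Lemma dot0r k (w : 'rV[R]_k) : dot w 0 = 0.
Proof. by rewrite /dot trmx0 mulmx0 mxE. Qed.

Lemma quadE k (H : 'M[R]_k) d : quad H d = dot (d *m H) d.
Proof. by []. Qed.

Lemma quadZ k (H : 'M[R]_k) c d : quad H (c *: d) = c ^+ 2 * quad H d.
Proof. by rewrite !quadE -scalemxAl dotZl dotZr mulrA expr2. Qed.

Lemma coord_comp_continuous (T : topologicalType) k (u : T -> 'rV[R]_k) i :
  continuous u -> continuous (fun t => u t 0 i).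
Proof.
move=> uc t; apply: (@continuous_comp _ _ _ u (fun M => M 0 i)); first exact: uc.
exact: coord_continuous.
Qed.

Lemma dot_continuous (T : topologicalType) k (u v : T -> 'rV[R]_k) :
  continuous u -> continuous v -> continuous (fun t => dot (u t) (v t)).
Proof.
move=> uc vc; rewrite (_ : (fun t => _) = fun t => \sum_i u t 0 i * v t 0 i); last first.
  by apply/funext => t; rewrite dotE.
apply: (@continuous_big _ _ +%R 0 xpredT _ _ _ (fun i t => u t 0 i * v t 0 i)).
  exact: add_continuous.
move=> i _ t; apply: cvgM.
  exact: coord_comp_continuous uc t.
exact: coord_comp_continuous vc t.
Qed.

Lemma rV_continuous (T : topologicalType) k (u : T -> 'rV[R]_k) :
  (forall i, continuous (fun t => u t 0 i)) -> continuous u.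
Proof.
move=> uc t; apply/cvgrPdist_le => e e0; near=> s.
apply: rV_norm_le => [|i]; first exact: ltW.
rewrite !mxE; move: i; near: s; apply: filter_forall => i.
by move/cvgrPdist_le : (uc i t) => /(_ _ e0).
Unshelve. all: by end_near. Qed.

Lemma row_mx_continuous (T : topologicalType) n m
    (u : T -> 'rV[R]_n) (v : T -> 'rV[R]_m) :
  continuous u -> continuous v -> continuous (fun t => row_mx (u t) (v t)).
Proof.
move=> uc vc; apply: rV_continuous => i; under eq_fun do rewrite mxE.
by case: (fintype.split i) => j; exact: coord_comp_continuous.
Qed.

Lemma quad_continuous k (H : 'M[R]_k) : continuous (quad H).
Proof.
apply: dot_continuous => [|x]; last exact: cvg_id.
apply: rV_continuous => i; under eq_fun do rewrite mxE.
apply: (@continuous_big _ _ +%R 0 xpredT _ _ _ (fun j (t : 'rV[R]_k) => t 0 j * H j i)).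
  exact: add_continuous.
by move=> j _ x; apply: (@cvgMr_tmp _ _ (nbhs x)); exact: coord_continuous.
Qed.

End RowVectors.

(** * Mean value theorem and Taylor expansions of orders one and two *)

Section Calculus.
Context {R : realType} {k : nat}.
Implicit Types (h : 'rV[R]_k -> R) (a d : 'rV[R]_k) (e : R).

Lemma derive_grad h a d : differentiable h a -> 'D_d h a = dot (grad h a) d.
Proof.
move=> dh; rewrite deriveE// {1}[d]row_sum_delta linear_sum dotE.
by apply: eq_bigr => i _; rewrite linearZ/= mxE deriveE//= mulrC.
Qed.

Lemma is_derive_line h a d (t : R) : (forall b, differentiable h b) ->
  is_derive t 1 (fun r => h (a + r *: d)) (dot (grad h (a + t *: d)) d).
Proof.
move=> dh; rewrite -derive_grad//.
(* The difference quotient of the restriction to the line is that of [h] along [d], so derivability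
   and the value of the derivative transfer together. *)
have E : (fun s : R => s^-1 *: (((fun r => h (a + r *: d)) \o shift t) (s *: 1)
    - h (a + t *: d))) =
    (fun s => s^-1 *: ((h \o shift (a + t *: d)) (s *: d) - h (a + t *: d))).
  apply/funext => s /=; rewrite [s *: 1]mulr1 scalerDl.
  by rewrite addrCA.
have : derivable h (a + t *: d) d by exact: diff_derivable.
by move=> dhd; split; rewrite /derivable /derive E.
Qed.

Lemma MVT_line h a d : (forall b, differentiable h b) ->
  exists2 t, 0 <= t <= 1 & h (a + d) - h a = dot (grad h (a + t *: d)) d.
Proof.
move=> dh; have [||t] := @MVT_segment _ (fun r => h (a + r *: d))
  (fun t => dot (grad h (a + t *: d)) d) 0 1 ler01.
- by move=> t _; exact: is_derive_line.
- apply: derivable_within_continuous => t _.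
  by have [] := is_derive_line a d t dh.
- rewrite in_itv/= scale1r scale0r addr0 subr0 mulr1 => t01 hE.
  by exists t.
Qed.

Lemma differentiable_expansion l (h : 'rV[R]_k -> 'rV[R]_l) a e :
  differentiable h a -> 0 < e ->
  exists2 r, 0 < r & forall d, `|d| < r ->
    `|h (a + d) - h a - d *m 'J h a| <= e * `|d|.
Proof.
move=> dh e0.
have /diff_locallyP[_ /eqaddoP/(_ _ e0)/nbhs_ballP[r r0 hr]] := dh.
exists r => // d dr; have := hr d; rewrite -ball_normE/= sub0r normrN => /(_ dr).
by rewrite mul_rV_lin1 !fctE/= [d + a]addrC opprD addrA.
Qed.

Lemma first_order_expansion h a e :
  (forall b, differentiable h b) -> 0 < e ->
  exists2 r, 0 < r & forall d, `|d| < r ->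
    `|h (a + d) - h a - dot (grad h a) d| <= e * `|d|.
Proof.
move=> dh e0.
have /diff_locallyP[_ /eqaddoP/(_ _ e0)/nbhs_ballP[r r0 hr]] := dh a.
exists r => // d dr; have := hr d; rewrite -ball_normE/= sub0r normrN => /(_ dr).
by rewrite -derive_grad// deriveE// !fctE/= [d + a]addrC opprD addrA.
Qed.

(** The mean value theorem on the segment from [c] to [b] yields the gradient at a point of the ball
    around [a], where it is close to [grad h a]. *)
Lemma strict_differentiability h a e :
  (forall b, differentiable h b) -> {for a, continuous (grad h)} -> 0 < e ->
  exists2 r, 0 < r & forall b c, `|b - a| < r -> `|c - a| < r ->
    `|h b - h c - dot (grad h a) (b - c)| <= e * `|b - c|.
Proof.
move=> dh gc e0; have k0 : 0 < (k.+1%:R : R) by [].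
move/cvgrPdist_le : gc => /(_ (e / k.+1%:R) (divr_gt0 e0 k0)) /nbhs_ballP[r r0 hr].
exists r => // b c br cr.
have [t /andP[t0 t1]] := MVT_line c (b - c) dh; rewrite subrKC => ->.
rewrite -dotBl (le_trans (dot_norm_le _ _))// mulrA ler_wpM2r//.
have := hr (c + t *: (b - c)); rewrite -ball_normE /= distrC [in X in _ -> X]distrC.
have -> : c + t *: (b - c) - a = t *: (b - a) + (1 - t) *: (c - a).
  by rewrite !scalerBr !scalerBl !scale1r; apply/rowP => i; rewrite !mxE; ring.
have cvx : `|t *: (b - a) + (1 - t) *: (c - a)| < r.
  rewrite (le_lt_trans (ler_normD _ _))// !normrZ !ger0_norm ?subr_ge0//.
  (* For [t > 0] the term in [b - a] makes the sum strictly less than [r]; at [t = 0] only the term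
     in [c - a] remains. *)
  have [->|tn0] := eqVneq t 0; first by rewrite mul0r add0r subr0 mul1r.
  have tp : 0 < t by rewrite lt_def tn0.
  by have : 0 <= `|c - a| by []; nra.
move=> /(_ cvx) H; apply: (@le_trans _ _ (k.+1%:R * (e / k.+1%:R))); last first.
  by rewrite mulrCA divff ?mulr1// gt_eqF.
by rewrite ler_pM// ler_nat.
Qed.

(** The mean value theorem is applied to the remainder [f] along the segment: its derivative [df t]
    is the first-order error of [grad h] at displacement [t *: d], paired with [d], hence a small
    multiple of the squared norm of [d]. *)
Lemma second_order_expansion h a e :
  (forall b, differentiable h b) -> differentiable (grad h) a -> 0 < e ->
  exists2 r, 0 < r & forall d, `|d| < r ->
    `|h (a + d) - h a - dot (grad h a) d - 2^-1 * quad (hess h a) d|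
      <= e * `|d| ^+ 2.
Proof.
move=> dh dg e0; have k0 : 0 < (k.+1%:R : R) by [].
have [r r0 hr] := differentiable_expansion dg (divr_gt0 e0 k0).
exists r => // d dr.
pose f (t : R) := h (a + t *: d) - t * dot (grad h a) d
  - t ^+ 2 * (2^-1 * quad (hess h a) d).
pose df (t : R) := dot (grad h (a + t *: d)) d - dot (grad h a) d
  - t * quad (hess h a) d.
have fD (t : R) : is_derive t (1 : R) f (df t).
  have D1 := is_derive_line a d t dh.
  rewrite /f; apply: is_derive_eq.
  by rewrite /df /GRing.scale/=; field.
have [|t] := @MVT_segment _ f df 0 1 ler01 (fun t _ => fD t).
  by apply: derivable_within_continuous => t _; have [] := fD t.
rewrite in_itv/= => /andP[t0 t1]; rewrite /f scale1r scale0r addr0 !mul1r.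
rewrite expr0n/= expr1n !mul0r !subr0 mul1r mulr1 => fE.
have -> : h (a + d) - h a - dot (grad h a) d - 2^-1 * quad (hess h a) d = df t.
  by rewrite -fE; ring.
have -> : df t = dot (grad h (a + t *: d) - grad h a - (t *: d) *m 'J (grad h) a) d.
  by rewrite /df quadE !dotBl -scalemxAl dotZl.
have td : `|t *: d| <= `|d| by rewrite normrZ ger0_norm// ler_piMl.
have := hr (t *: d) (le_lt_trans td dr) => H.
rewrite (le_trans (dot_norm_le _ _))// mulrA expr2 mulrA ler_wpM2r//.
apply: (@le_trans _ _ (k.+1%:R * (e / k.+1%:R * `|d|))); last first.
  by rewrite mulrA mulrCA divff ?mulr1// gt_eqF.
rewrite ler_pM ?ler_nat//; apply: (le_trans H).
by rewrite ler_wpM2l// divr_ge0// ltW.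
Qed.

End Calculus.

(** * Twice differentiable functions *)

Section TwiceDifferentiable.
Context {R : realType} {k : nat}.
Implicit Types (f g : 'rV[R]_k -> R).

(** This class is stable under the operations that build both Lagrangians from the data. *)
Definition twice_differentiable f :=
  (forall a, differentiable f a) /\ (forall a, differentiable (grad f) a).

Lemma twice_differentiableD f g :
  twice_differentiable f -> twice_differentiable g ->
  twice_differentiable (fun a => f a + g a).
Proof.
move=> [df ddf] [dg ddg].
have -> : (fun a => f a + g a) = f + g by [].
split=> a; first exact: differentiableD.
have -> : grad (f + g) = grad f + grad g.
  apply/funext => b; apply/rowP => i; rewrite !mxE.
  by rewrite deriveD//; exact: diff_derivable.
exact: differentiableD.
Qed.

Lemma twice_differentiableZ c f :
  twice_differentiable f -> twice_differentiable (fun a => c * f a).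
Proof.
move=> [df ddf].
have -> : (fun a => c * f a) = c *: f by [].
split=> a; first exact: differentiableZ.
have -> : grad (c *: f) = c *: grad f.
  apply/funext => b; apply/rowP => i; rewrite !mxE.
  by rewrite deriveZ//; exact: diff_derivable.
exact: differentiableZ.
Qed.

Lemma twice_differentiable_cst c : twice_differentiable (fun _ => c).
Proof.
split=> a; first exact: differentiable_cst.
have -> : grad (fun _ : 'rV[R]_k => c) = (fun _ => 0).
  by apply/funext => b; apply/rowP => i; rewrite !mxE derive_cst.
exact: differentiable_cst.
Qed.

Lemma twice_differentiable_dot l (u : 'rV[R]_l) (h : 'rV[R]_k -> 'rV[R]_l) :
  (forall i, twice_differentiable (fun a => h a 0 i)) ->
  twice_differentiable (fun a => dot u (h a)).
Proof.
move=> dh; under eq_fun do rewrite dotE.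
elim: (index_enum _) => [|i r IH].
  by under eq_fun do rewrite big_nil; exact: twice_differentiable_cst.
under eq_fun do rewrite big_cons.
by apply: twice_differentiableD => //; apply: twice_differentiableZ.
Qed.

Lemma C2_twice_differentiable f : C2 f -> twice_differentiable f.
Proof. by case. Qed.

End TwiceDifferentiable.

(** * Joint and partial gradients *)

Section Partial.
Context {R : realType} {n m : nat}.
Implicit Types (h : 'rV[R]_n -> 'rV[R]_m -> R).

Lemma joint_row_mx h x y : joint h (row_mx x y) = h x y.
Proof. by rewrite /joint row_mxKl row_mxKr. Qed.

(** Each basis vector of the product space lies in one of the two blocks, and along it the
    difference quotients of [joint h] are literally those of a partial function. *)
Lemma jgradE h x y : jgrad h x y = row_mx (grad (h^~ y) x) (grad (h x) y).
Proof.
have rowE (b : R) (u v : 'rV[R]_n) (w z : 'rV[R]_m) :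
  b *: row_mx u w + row_mx v z = row_mx (b *: u + v) (b *: w + z).
  by rewrite scale_row_mx add_row_mx.
have deriveext (V W : normedModType R) (f : V -> R) (g : W -> R) a b u v :
    (forall t : R, f (t *: u + a) = g (t *: v + b)) -> f a = g b ->
    'D_u f a = 'D_v g b.
  move=> fg fagb; rewrite /derive; suff -> : (fun t : R => t^-1 *:
    ((f \o shift a) (t *: u) - f a)) = (fun t : R => t^-1 *:
    ((g \o shift b) (t *: v) - g b)) by [].
  by apply/funext => t /=; rewrite fg fagb.
apply/rowP => i; rewrite !mxE; case: splitP => j ij; rewrite mxE.
- have -> : delta_mx 0 i = row_mx (delta_mx 0 j) 0 :> 'rV[R]_(n + m).
    apply/rowP => l; rewrite !mxE eqxx /= -(inj_eq val_inj l i) /= ij.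
    case: splitP => l' ll'; rewrite !mxE ?eqxx ll' ?val_eqE//.
    by rewrite gtn_eqF// ltn_addr.
  apply: deriveext => [t|].
    by rewrite rowE; apply: etrans (joint_row_mx _ _ _) _; rewrite scaler0 add0r.
  exact: joint_row_mx.
- have -> : delta_mx 0 i = row_mx 0 (delta_mx 0 j) :> 'rV[R]_(n + m).
    apply/rowP => l; rewrite !mxE eqxx /= -(inj_eq val_inj l i) /= ij.
    case: splitP => l' ll'; rewrite !mxE ?eqxx ll' ?eqn_add2l ?val_eqE//.
    by rewrite ltn_eqF// ltn_addr.
  apply: deriveext => [t|].
    by rewrite rowE; apply: etrans (joint_row_mx _ _ _) _; rewrite scaler0 add0r.
  exact: joint_row_mx.
Qed.

End Partial.

(** * Uniformity over finite families and on the unit sphere *)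

(** By monotonicity each [P i] holds for all small positive radii, and a filter is closed under
    finite intersections. This gives one radius for all constraints. *)
Lemma uniform_radius (R : realType) (I : finType) (P : I -> R -> Prop) :
  (forall i r r', r' <= r -> P i r -> P i r') ->
  (forall i, exists2 r, 0 < r & P i r) -> exists2 r, 0 < r & forall i, P i r.
Proof.
move=> Pmono Pex.
have : \forall r \near 0^'+, forall i, P i r.
  apply: filter_forall => i; have [r r0 Pr] := Pex i.
  near=> s; apply: Pmono Pr; near: s; exact: nbhs_right_le.
move=> H; near ((0:R)^'+) => r; exists r; first by [].
by near: r.
Unshelve. all: by end_near. Qed.

Section Dichotomy.
Context {R : realType} {k : nat} {I : finType}.
Variables (Q : 'rV[R]_k -> R) (N : I -> 'rV[R]_k -> R).

(* A quantitative form, by compactness of the unit sphere, of the positivity of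
   a quadratic form on a subspace. *)
Lemma positive_on_kernel_dichotomy :
  continuous Q -> (forall i, continuous (N i)) ->
  (forall c d, Q (c *: d) = c ^+ 2 * Q d) ->
  (forall i c d, N i (c *: d) = c * N i d) ->
  (forall d, d != 0 -> (forall i, N i d = 0) -> 0 < Q d) ->
  exists2 c, 0 < c &
    forall d, c * `|d| ^+ 2 <= Q d \/ exists i, c * `|d| <= `|N i d|.
Proof.
move=> Qc Nc QZ NZ Qpos.
have Q0 : Q 0 = 0 by rewrite -[0 in LHS](scale0r 0) QZ expr0n mul0r.
pose A : set 'rV[R]_k := [set d | `|d| = 1].
have AP d : d != 0 -> A (`|d|^-1 *: d).
  by move=> d0; rewrite /A/= normrZ normfV normr_id mulVf// normr_eq0.
(* If the sphere is empty, every [d] is 0 and the first alternative is trivial. *)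
have [A0|] := pselect (A !=set0); last first.
  move=> A0; exists 1 => // d; left; have [->|/AP dA] := eqVneq d 0.
    by rewrite normr0 Q0 expr0n mulr0.
  by exfalso; apply: A0; exists (`|d|^-1 *: d).
have Acomp : compact A.
  apply: bounded_closed_compact.
    by exists 1; split=> // M M1 d /= ->; exact: ltW.
  rewrite (_ : A = Num.norm @^-1` [set 1]); last by apply/seteqP; split.
  apply: closed_comp; last exact: closed_eq.
  by move=> d _; exact: norm_continuous.
pose S d := \sum_i `|N i d|.
have Sc : continuous S.
  apply: (@continuous_big _ _ +%R 0 xpredT _ _ _ (fun i d => `|N i d|)).
    exact: add_continuous.
  move=> i _ d; apply: (@continuous_comp _ _ _ (N i) Num.norm); first exact: Nc.
  exact: norm_continuous.
(* The minimum over the sphere of the larger of [Q] and [S] is positive: where [S] vanishes, all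
   [N i] do, and [Q] is positive. *)
have [d0 d0A min0] := @EVT_min_rV R k (fun d => Num.max (Q d) (S d)) A A0 Acomp
  (continuous_subspaceT (fun d => continuous_max (@Qc d) (@Sc d))).
move: d0A; rewrite inE => d0A.
have S_ge0 d : 0 <= S d by apply: sumr_ge0.
pose mu := Num.max (Q d0) (S d0).
have mu0 : 0 < mu.
  rewrite lt_max; have [//|/= Q0d] := ltP 0 (Q d0).
  rewrite lt_def S_ge0 andbT; apply/negP => /eqP S0.
  move: Q0d; rewrite leNgt => /negP; apply; apply: Qpos => [|i].
    apply/eqP => d00; move: d0A; rewrite /A/= d00 normr0.
    by apply/eqP; rewrite eq_sym oner_eq0.
  apply/eqP; rewrite -normr_eq0; move: S0 => /eqP; rewrite psumr_eq0// => /allP/(_ i).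
  by rewrite mem_index_enum => /(_ isT).
have K0 : 0 < (#|I|.+1%:R : R) by [].
(* If all the [N i] were below this constant on the sphere, [S] would be strictly below [mu]; the
   successor provides the strictness and covers an empty [I]. *)
exists (mu / #|I|.+1%:R) => [|d]; first exact: divr_gt0.
have [->|dn0] := eqVneq d 0; first by left; rewrite normr0 Q0 expr0n mulr0.
have cmu : mu / #|I|.+1%:R <= mu by rewrite ler_pdivrMr// ler_peMr ?ler1n// ltW.
have nd0 : 0 < `|d| by rewrite normr_gt0.
have := min0 _ (mem_set (AP _ dn0)); rewrite -/mu le_max => /orP[Qe|Se].
  have dE : d = `|d| *: (`|d|^-1 *: d) by rewrite scalerA divff ?scale1r// gt_eqF.
  left; rewrite [X in _ <= Q X]dE QZ mulrC.
  by rewrite ler_wpM2l ?exprn_ge0//; exact: le_trans Qe.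
right; apply: contrapT => /forallNP nN.
move: Se; rewrite leNgt => /negP; apply.
apply: (@le_lt_trans _ _ (\sum_(i : I) (mu / #|I|.+1%:R))).
  apply: ler_sum => i _; rewrite NZ normrM normfV normr_id mulrC ler_pdivrMr//.
  by rewrite leNgt; apply/negP => /ltW; exact: nN.
by rewrite sumr_const -[_ *+ _]mulr_natr mulrAC ltr_pdivrMr// ltr_pM2l// ltr_nat.
Qed.

End Dichotomy.

(** * Solving the active constraints by a fixed point *)

Section ImplicitFunction.
Context {R : realType}.

(* The library lacks this join of the complete and normed structures. *)
HB.instance Definition _ n m := Complete.on 'M[R]_(n, m).

(** The matrix [B] of the selected vectors is row-free, so it has a right inverse [B'], whose
    columns are dual to those vectors. [M] combines these columns with the coordinates of [a] that
    [S] selects. *)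
Lemma free_dual_basis q m (V : 'I_q -> 'rV[R]_m) (P : pred 'I_q) :
  free [seq V j | j <- enum 'I_q & P j] ->
  exists M : 'M[R]_(q, m), forall j, P j -> forall a, dot (V j) (a *m M) = a 0 j.
Proof.
set s := [seq j <- _ | _] => fr.
pose t := in_tuple s.
pose B := \matrix_(i < size s) V (tnth t i).
have /row_freeP[B' BB'] : row_free B.
  rewrite -kermx_eq0; apply/rowV0P => v /sub_kermxP vB.
  have /freeP fr' : free (map_tuple V t) by [].
  apply/rowP => i; rewrite mxE; apply: (fr' (fun i => v 0 i)).
  rewrite -[RHS]vB mulmx_sum_row; apply: eq_bigr => l _.
  by rewrite rowK -tnth_nth tnth_map.
pose S : 'M[R]_(size s, q) := \matrix_(i, j) (tnth t i == j)%:R.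
exists (S^T *m B'^T) => j Pj a.
have /tnthP[i ji] : j \in t by rewrite mem_filter Pj mem_enum.
have -> : V j = row i B by rewrite rowK ji.
rewrite /dot !trmx_mul !trmxK !mulmxA -!row_mul BB' mul1mx !mxE.
rewrite (bigD1 j)//= big1 ?addr0 => [|l lj]; rewrite !mxE.
  by rewrite -ji eqxx mul1r.
by rewrite -ji eq_sym (negbTE lj) mul0r.
Qed.

Lemma mulmx_norm_le q m (a : 'rV[R]_q) (M : 'M[R]_(q, m)) :
  `|a *m M| <= q%:R * `|M| * `|a|.
Proof.
apply: rV_norm_le => [|i]; first by rewrite !mulr_ge0.
rewrite mxE (le_trans (ler_norm_sum _ _ _))//.
rewrite -mulrA -[q in q%:R]card_ord mulr_natl -sumr_const ler_sum// => j _.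
rewrite normrM mulrC ler_pM// ?coord_norm_le//.
rewrite [leRHS]/Num.norm/= mx_normrE.
exact: (le_bigmax _ (fun ij : 'I_q * 'I_m => `|M ij.1 ij.2|) (j, i)).
Qed.

Lemma contraction_fixpoint q (T : 'rV[R]_q -> 'rV[R]_q) tau :
  0 <= tau -> (forall a, `|a| <= tau -> `|T a| <= tau) ->
  (forall a b, `|a| <= tau -> `|b| <= tau -> `|T a - T b| <= 2^-1 * `|a - b|) ->
  exists2 a, `|a| <= tau & T a = a.
Proof.
move=> tau0 Ttau Tctr; pose U : set 'rV[R]_q := [set a | `|a| <= tau].
have TU : {homo T : a / U a >-> U a} by [].
have := @banach_fixed_point R 'rV[R]_q U (mkfun TU).
have ctr : is_contraction (mkfun TU : {fun U >-> U}).
  exists (2^-1)%:nng; split=> /=; first by rewrite invf_lt1 ?ltr1n.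
  by move=> [a b] /= [Ua Ub]; exact: Tctr.
move=> /(_ ctr); case=> [||a Ua /esym aT]; last by exists a.
- rewrite (_ : U = Num.norm @^-1` [set r | r <= tau]); last by apply/seteqP; split.
  apply: closed_comp; last exact: closed_le.
  by move=> d _; exact: norm_continuous.
- by exists 0; rewrite /U/= normr0.
Qed.

(* The unknown is sought in the form [y0 + a *m M], in which the equations have
   the identity as their derivative with respect to [a]. *)
Lemma solve_active_constraints n m q (h : 'I_q -> 'rV[R]_(n + m) -> R)
    (P : pred 'I_q) (x0 : 'rV[R]_n) (y0 : 'rV[R]_m) (M : 'M[R]_(q, m)) :
  (forall j, twice_differentiable (h j)) ->
  (forall j, P j -> h j (row_mx x0 y0) = 0) ->
  (forall j, P j -> forall a,
    dot (grad (h j) (row_mx x0 y0)) (row_mx 0 (a *m M)) = a 0 j) ->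
  forall rho, 0 < rho -> exists2 delta, 0 < delta &
    forall x, `|x - x0| < delta ->
      exists2 y, `|y - y0| < rho & forall j, P j -> h j (row_mx x y) = 0.
Proof.
move=> dh h0 hM rho rho0.
(* [C] bounds the operator [a *m M]; the added 1 makes it positive. *)
pose C := q%:R * `|M| + 1.
have C0 : 0 < C by rewrite ltr_wpDl// mulr_ge0.
have aMC (a : 'rV[R]_q) : `|a *m M| <= C * `|a|.
  by rewrite (le_trans (mulmx_norm_le _ _))// ler_wpM2r// lerDl.
have e0 : 0 < (2 * C)^-1 by rewrite invr_gt0 mulr_gt0.
set s0 := row_mx x0 y0.
have [r r0 hr] : exists2 r, 0 < r & forall j, forall b c,
    `|b - s0| < r -> `|c - s0| < r ->
    `|h j b - h j c - dot (grad (h j) s0) (b - c)| <= (2 * C)^-1 * `|b - c|.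
  apply: uniform_radius => [j r r' rr' H b c br cr|j].
    by apply: H; exact: lt_le_trans rr'.
  apply: strict_differentiability => //; first exact: (dh j).1.
  exact/differentiable_continuous/(dh j).2.
(* This makes [C * tau] half of the smaller of [r] and [rho]: for [a] of norm at most [tau], the
   point [y0 + a *m M] stays within both radii of [y0]. *)
pose tau := Num.min r rho / (2 * C).
have tau0 : 0 < tau by rewrite divr_gt0 ?mulr_gt0// lt_min r0.
have Ctau : C * tau < Num.min r rho.
  have -> : C * tau = Num.min r rho / 2 by rewrite /tau; field; rewrite gt_eqF.
  by rewrite ltr_pdivrMr// ltr_pMr ?ltr1n// lt_min r0.
(* The residual at [a = 0] is at most [tau / 2]; with contraction factor one half, [T] then maps the
   ball of radius [tau] into itself. *)
have [delta delta0 hdelta] : exists2 delta, 0 < delta & forall j, forall x,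
    `|x - x0| < delta -> `|h j (row_mx x y0) - h j s0| <= tau / 2.
  apply: uniform_radius => [j e e' ee' H x xe|j].
    by apply: H; exact: lt_le_trans ee'.
  have := differentiable_continuous ((dh j).1 s0).
  move/cvgrPdist_le => /(_ (tau / 2) (divr_gt0 tau0 (ltr0Sn _ 1))).
  move=> /nbhs_ballP[e e0' he]; exists e => // x xe; rewrite distrC; apply: he.
  rewrite -ball_normE/= opp_row_mx add_row_mx subrr.
  by apply: le_lt_trans xe; apply: row_mx_norm_le; rewrite ?normr0// distrC.
exists (Num.min delta r); first by rewrite lt_min delta0.
move=> x; rewrite lt_min => /andP[xdelta xr].
pose Y (a : 'rV[R]_q) := row_mx x (y0 + a *m M).
(* A Newton map with the derivative frozen at the base point, where it is the identity: its fixed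
   points solve the equations selected by [P]. *)
pose T (a : 'rV[R]_q) : 'rV[R]_q :=
  \row_j (if P j then a 0 j - h j (Y a) else 0).
have Yr a : `|a| <= tau -> `|Y a - s0| < r.
  move=> atau; rewrite /Y opp_row_mx add_row_mx addrAC subrr add0r.
  have aMr : `|a *m M| < r.
    rewrite (le_lt_trans (aMC _))//; apply: le_lt_trans (lt_le_trans Ctau _).
      by rewrite ler_pM2l.
    by rewrite ge_min lexx.
  apply: (@le_lt_trans _ _ (Num.max `|x - x0| `|a *m M|)).
    by apply: row_mx_norm_le; rewrite le_max lexx ?orbT.
  by rewrite gt_max xr.
have Tctr a b : `|a| <= tau -> `|b| <= tau -> `|T a - T b| <= 2^-1 * `|a - b|.
  move=> atau btau; apply: rV_norm_le => [|j]; first by rewrite mulr_ge0.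
  rewrite !mxE; case: ifPn => Pj; last by rewrite subrr normr0 mulr_ge0.
  have YB : Y a - Y b = row_mx 0 ((a - b) *m M).
    rewrite /Y opp_row_mx add_row_mx subrr mulmxBl; congr row_mx.
    by rewrite opprD addrACA subrr add0r.
  (* Up to sign, a coordinate of [T a - T b] is the error of strict differentiability between [Y a]
     and [Y b]. *)
  have := hr j (Y a) (Y b) (Yr _ atau) (Yr _ btau); rewrite YB hM// !mxE.
  have -> : a 0 j - h j (Y a) - (b 0 j - h j (Y b)) =
    - (h j (Y a) - h j (Y b) - (a 0 j - b 0 j)) by ring.
  rewrite normrN => /le_trans; apply.
  apply: (@le_trans _ _ ((2 * C)^-1 * (C * `|a - b|))).
    rewrite ler_pM2l//; apply: row_mx_norm_le (aMC _).
    by rewrite normr0 mulr_ge0// ltW.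
  by rewrite mulrA invfM mulfVK// gt_eqF.
have [a atau|a b|a atau aT] := @contraction_fixpoint q T tau (ltW tau0) _ _.
- rewrite -[T a](subrK (T 0)) (le_trans (ler_normD _ _))//.
  rewrite [leRHS]splitr lerD//.
    rewrite (le_trans (Tctr _ _ _ _)) ?normr0 ?subr0//; first exact: ltW.
    by rewrite mulrC ler_pM2r ?invr_gt0.
  apply: rV_norm_le => [|j]; first by rewrite divr_ge0// ltW.
  rewrite !mxE; case: ifPn => Pj; last by rewrite normr0 divr_ge0// ltW.
  have := hdelta j x xdelta; rewrite h0// subr0 /Y mul0mx addr0.
  by rewrite sub0r normrN.
- exact: Tctr.
- exists (y0 + a *m M) => [|j Pj].
    rewrite addrAC subrr add0r (le_lt_trans (aMC _))//.
    apply: le_lt_trans (lt_le_trans Ctau _); first by rewrite ler_pM2l.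
    by rewrite ge_min lexx orbT.
  have /rowP/(_ j) := aT; rewrite mxE Pj => /eqP.
  by rewrite -subr_eq0 addrAC subrr add0r oppr_eq0 => /eqP.
Qed.

End ImplicitFunction.

(** * Expansions in two block variables *)

Section Expansions.
Context {R : realType} {n m : nat}.
Variables (h : 'rV[R]_n -> 'rV[R]_m -> R) (x0 : 'rV[R]_n) (y0 : 'rV[R]_m).
Hypothesis dh : twice_differentiable (joint h).

(** The common bound [t] allows the errors at [(x, y)] and at [(x, z)] to be measured by the norm of
    one displacement in all three variables. *)
Lemma joint_first_order_expansion (e : R) : 0 < e -> exists2 r, 0 < r &
  forall x y t, `|x - x0| <= t -> `|y - y0| <= t -> t < r ->
    `|h x y - h x0 y0 - dot (jgrad h x0 y0) (row_mx (x - x0) (y - y0))| <= e * t.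
Proof.
move=> e0; have [r r0 hr] := first_order_expansion (row_mx x0 y0) dh.1 e0.
exists r => // x y t xt yt tr; have dt := row_mx_norm_le xt yt.
have := hr _ (le_lt_trans dt tr); rewrite add_row_mx !subrKC !joint_row_mx.
by move/le_trans; apply; rewrite ler_pM2l.
Qed.

Lemma joint_second_order_expansion (e : R) : 0 < e -> exists2 r, 0 < r &
  forall x y t, `|x - x0| <= t -> `|y - y0| <= t -> t < r ->
    `|h x y - h x0 y0 - dot (jgrad h x0 y0) (row_mx (x - x0) (y - y0))
      - 2^-1 * quad (jhess h x0 y0) (row_mx (x - x0) (y - y0))| <= e * t ^+ 2.
Proof.
move=> e0.
have [r r0 hr] := second_order_expansion dh.1 (dh.2 (row_mx x0 y0)) e0.
exists r => // x y t xt yt tr; have dt := row_mx_norm_le xt yt.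
have := hr _ (le_lt_trans dt tr); rewrite add_row_mx !subrKC !joint_row_mx.
move/le_trans; apply; rewrite ler_pM2l// lerXn2r ?nnegrE//.
exact: le_trans dt.
Qed.

End Expansions.

(** * Complementary vectors *)

Section Complementarity.
Context {R : realType} {k : nat}.
Implicit Types u s : 'rV[R]_k.

(** All terms of the dot product are nonpositive, so none can exceed the whole sum in absolute
    value. *)
Lemma norm_term_le_oppr_dot u s i :
  (forall i, 0 <= u 0 i) -> nonpos s -> `|u 0 i * s 0 i| <= - dot u s.
Proof.
move=> u0 s0; have us j : 0 <= - (u 0 j * s 0 j) by rewrite oppr_ge0 mulr_ge0_le0.
rewrite dotE -sumrN (bigD1 i)//= ler0_norm; last by rewrite -oppr_ge0.
by rewrite lerDl sumr_ge0.
Qed.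

Lemma complementary_mul0 u s i : complementary u s -> u 0 i * s 0 i = 0.
Proof.
move=> [u0 s0 us0]; apply/eqP.
by have := norm_term_le_oppr_dot i u0 s0; rewrite us0 oppr0 normr_le0.
Qed.

End Complementarity.

(** * Value function and feasible selection of the lower level *)

Section LowerLevel.
Context {R : realType} {n m q : nat}.
Variables (f : 'rV[R]_n -> 'rV[R]_m -> R) (g : 'rV[R]_n -> 'rV[R]_m -> 'rV[R]_q).

(** A minimizer bounds the set of values from below, which makes [inf] a genuine lower bound. *)
Lemma lower_value_le x z :
  lower_argmin f g x !=set0 -> lower_feasible g x z -> lower_value f g x <= f x z.
Proof.
move=> [z' [_ z'min]] zx; apply: ge_inf; last by exists z.
by exists (f x z') => _ [z'' z''x <-]; exact: z'min.
Qed.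

Lemma lower_value_ge x z : lower_argmin f g x z -> f x z <= lower_value f g x.
Proof.
move=> [zx zmin]; apply: lb_le_inf; first by exists (f x z), z.
by move=> _ [z' z'x <-]; exact: zmin.
Qed.

(** LLICQ supplies the matrix [M] with which the active constraints are solved as equations; by
    continuity the inactive ones remain negative near [(x0, y0)], so the solution is feasible. *)
Lemma active_constraint_selection x0 y0 :
  (forall j, twice_differentiable (joint (component g j))) ->
  lower_feasible g x0 y0 -> LLICQ g x0 y0 ->
  forall rho, 0 < rho -> exists2 delta, 0 < delta &
    forall x, `|x - x0| < delta -> exists z,
      [/\ `|z - y0| < rho, lower_feasible g x z
        & forall j, g x0 y0 0 j = 0 -> g x z 0 j = 0].
Proof.
move=> dg fea licq rho rho0; pose P j := g x0 y0 0 j == 0.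
have [M hM] := @free_dual_basis _ _ _ (fun j => grad (component g j x0) y0) P licq.
have [r r0 hr] : exists2 r, 0 < r & forall j, forall s,
    `|s - row_mx x0 y0| < r -> P j \/ joint (component g j) s < 0.
  apply: uniform_radius => [j r r' rr' H s sr|j].
    by apply: H; exact: lt_le_trans rr'.
  have [gj|gj] := eqVneq (g x0 y0 0 j) 0; first by exists 1 => // s _; left; apply/eqP.
  have gj0 : joint (component g j) (row_mx x0 y0) < 0.
    by rewrite joint_row_mx lt_neqAle gj fea.
  have := differentiable_continuous ((dg j).1 (row_mx x0 y0)).
  move/cvgrPdist_lt => /(_ (- joint (component g j) (row_mx x0 y0))).
  rewrite oppr_gt0 => /(_ gj0) /nbhs_ballP[r r0 hr]; exists r => // s sr; right.
  have := hr s; rewrite -ball_normE/= distrC => /(_ sr).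
  by rewrite ltr_norml => /andP[+ _]; rewrite opprK ltrDl oppr_gt0.
have rho'0 : 0 < Num.min rho r by rewrite lt_min rho0.
have [||delta delta0 hdelta] :=
    @solve_active_constraints R n m q (fun j => joint (component g j)) P x0 y0 M dg
      _ _ _ rho'0.
- by move=> j /eqP gj; rewrite joint_row_mx.
- by move=> j Pj a; rewrite -/(jgrad _ _ _) jgradE dot_row_mx dot0r add0r hM.
exists (Num.min delta r) => [|x]; first by rewrite lt_min delta0.
rewrite lt_min => /andP[/hdelta[z]]; rewrite lt_min => /andP[zrho zr] gz xr.
exists z; split=> // j; last by move/eqP/gz; rewrite joint_row_mx.
have zs : `|row_mx x z - row_mx x0 y0| < r.
  rewrite opp_row_mx add_row_mx.
  apply: (@le_lt_trans _ _ (Num.max `|x - x0| `|z - y0|)).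
    by apply: row_mx_norm_le; rewrite le_max lexx ?orbT.
  by rewrite gt_max xr.
have [/gz|] := hr j _ zs; rewrite joint_row_mx; first by rewrite /component => ->.
exact: ltW.
Qed.

End LowerLevel.

(** * Quantitative second-order condition *)

Section SecondOrderGrowth.
Context {R : realType} {n m : nat} {I J : finType}.
Variables (H1 H2 : 'M[R]_(n + m)) (lam : R).
Variables (A : I -> 'rV[R]_(n + m)) (B : J -> 'rV[R]_(n + m)).

(** This is [positive_on_kernel_dichotomy] on the space of triples [(d1, d2, d3)], with the linear
    forms of [A] and [B] indexed by a disjoint sum. *)
Lemma second_order_growth :
  (forall (d1 : 'rV[R]_n) (d2 d3 : 'rV[R]_m),
    (forall i, dot (A i) (row_mx d1 d2) = 0) ->
    (forall j, dot (B j) (row_mx d1 d3) = 0) ->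
    (d1, d2, d3) <> (0, 0, 0) ->
    lam * quad H2 (row_mx d1 d3) < quad H1 (row_mx d1 d2)) ->
  exists2 c, 0 < c & forall (d1 : 'rV[R]_n) (d2 d3 : 'rV[R]_m),
    let t := `|row_mx (row_mx d1 d2) d3| in
    [\/ c * t ^+ 2 <= quad H1 (row_mx d1 d2) - lam * quad H2 (row_mx d1 d3),
        exists i, c * t <= `|dot (A i) (row_mx d1 d2)|
      | exists j, c * t <= `|dot (B j) (row_mx d1 d3)|].
Proof.
move=> pos.
pose D12 (d : 'rV[R]_(n + m + m)) : 'rV[R]_(n + m) := lsubmx d.
pose D13 (d : 'rV[R]_(n + m + m)) := row_mx (lsubmx (lsubmx d)) (rsubmx d).
pose Q (d : 'rV[R]_(n + m + m)) := quad H1 (D12 d) - lam * quad H2 (D13 d).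
pose N (i : I + J) (d : 'rV[R]_(n + m + m)) :=
  match i with inl i => dot (A i) (D12 d) | inr j => dot (B j) (D13 d) end.
have D12c : continuous D12 by exact: continuous_lsubmx.
have D13c : continuous D13.
  apply: row_mx_continuous; last exact: continuous_rsubmx.
  by move=> d; apply: continuous_comp; exact: continuous_lsubmx.
have D12Z a d : D12 (a *: d) = a *: D12 d by apply/rowP => i; rewrite !mxE.
have D13Z a d : D13 (a *: d) = a *: D13 d.
  by rewrite /D13 scale_row_mx; congr row_mx; apply/rowP => i; rewrite !mxE.
have [c c0 cQN] : exists2 c, 0 < c &
    forall d, c * `|d| ^+ 2 <= Q d \/ exists i, c * `|d| <= `|N i d|.
  apply: positive_on_kernel_dichotomy.
  - move=> d; apply: (@cvgB _ _ _ (nbhs d)).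
      apply: (@continuous_comp _ _ _ D12 (quad H1)); first exact: D12c.
      exact: quad_continuous.
    apply: (@cvgMl_tmp _ _ (nbhs d)).
    apply: (@continuous_comp _ _ _ D13 (quad H2)); first exact: D13c.
    exact: quad_continuous.
  - move=> [i|j].
      exact: (@dot_continuous _ _ _ (fun=> A i) D12 (@cst_continuous _ _ _) D12c).
    exact: (@dot_continuous _ _ _ (fun=> B j) D13 (@cst_continuous _ _ _) D13c).
  - by move=> a d; rewrite /Q D12Z D13Z !quadZ mulrBr [lam * (_ * _)]mulrCA.
  - by move=> [i|j] a d; rewrite /N ?D12Z ?D13Z dotZr.
  - move=> d d0 Nd; rewrite /Q subr_gt0 /D12 -[lsubmx d in ltRHS]hsubmxK.
    apply: pos.
    - by move=> i; rewrite hsubmxK; exact: (Nd (inl i)).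
    - by move=> j; exact: (Nd (inr j)).
    - move=> -[d1 d2 d3]; move/eqP: d0; apply.
      by rewrite -[d]hsubmxK -[lsubmx d]hsubmxK d1 d2 d3 !row_mx0.
exists c => // d1 d2 d3 t.
have := cQN (row_mx (row_mx d1 d2) d3).
rewrite /Q /N /D12 /D13 !(row_mxKl, row_mxKr) => -[|[[i|j]]] ?.
- exact: Or31.
- by apply: Or32; exists i.
- by apply: Or33; exists j.
Qed.

End SecondOrderGrowth.

(** * The two Lagrangians and the penalized objective *)

Section Lagrangians.
Context {R : realType} {n m p q : nat}.
Variables (F f : 'rV[R]_n -> 'rV[R]_m -> R).
Variables (G : 'rV[R]_n -> 'rV[R]_m -> 'rV[R]_p).
Variables (g : 'rV[R]_n -> 'rV[R]_m -> 'rV[R]_q).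
Hypotheses (dF : twice_differentiable (joint F))
  (df : twice_differentiable (joint f))
  (dG : forall i, twice_differentiable (joint (component G i)))
  (dg : forall j, twice_differentiable (joint (component g j))).

Lemma twice_differentiable_lagrangian lam u v :
  twice_differentiable (joint (lagrangian F f G g lam u v)).
Proof.
have -> : joint (lagrangian F f G g lam u v) = fun s =>
  joint F s + dot u (joint G s) + dot v (joint g s) + lam * joint f s by [].
apply: twice_differentiableD; last exact: twice_differentiableZ.
apply: twice_differentiableD; last exact: twice_differentiable_dot.
by apply: twice_differentiableD => //; exact: twice_differentiable_dot.
Qed.

Lemma twice_differentiable_lower_lagrangian w :
  twice_differentiable (joint (lower_lagrangian f g w)).
Proof.
have -> : joint (lower_lagrangian f g w) =
  fun s => joint f s + dot w (joint g s) by [].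
by apply: twice_differentiableD => //; exact: twice_differentiable_dot.
Qed.

(* The key is [lower_value f g x <= f x z = lower_lagrangian f g w x z]. *)
Lemma penalized_le_lagrangian lam x0 y0 u v w x y z :
  0 <= lam -> lower_argmin f g x0 y0 -> lower_argmin f g x !=set0 ->
  complementary u (G x0 y0) -> complementary v (g x0 y0) ->
  complementary w (g x0 y0) ->
  lower_feasible g x z -> (forall j, w 0 j * g x z 0 j = 0) ->
  penalized F f g lam (x, y) <= penalized F f g lam (x0, y0) ->
  lagrangian F f G g lam u v x y - lagrangian F f G g lam u v x0 y0
    - lam * (lower_lagrangian f g w x z - lower_lagrangian f g w x0 y0)
  <= dot u (G x y) + dot v (g x y).
Proof.
move=> lam0 y0min xmin [_ _ uG] [_ _ vg] [_ _ wg] zfea wgz.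
rewrite /penalized/= /lagrangian /lower_lagrangian uG vg wg.
have -> : dot w (g x z) = 0 by rewrite dotE big1.
have := ler_wpM2l lam0 (lower_value_le xmin zfea).
have := ler_wpM2l lam0 (lower_value_ge y0min).
lra.
Qed.

End Lagrangians.

(** * Strict local optimality at the stationary point *)

Theorem theorem6p2 (R : realType) (n m p q : nat)
    (F f : 'rV[R]_n -> 'rV[R]_m -> R)
    (G : 'rV[R]_n -> 'rV[R]_m -> 'rV[R]_p)
    (g : 'rV[R]_n -> 'rV[R]_m -> 'rV[R]_q)
    (F_C2 : C2 (joint F)) (f_C2 : C2 (joint f))
    (G_C2 : forall i, C2 (joint (component G i)))
    (g_C2 : forall j, C2 (joint (component g j)))
    (S_neq0 : forall x, lower_argmin f g x !=set0)
    (lam : R) (xb : 'rV[R]_n) (yb zb : 'rV[R]_m)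
    (ub : 'rV[R]_p) (vb wb : 'rV[R]_q)
    (lam_gt0 : 0 < lam)
    (zeta_stat : stationary F f G g lam xb yb zb ub vb wb)
    (S_yb : lower_argmin f g xb = [set yb])
    (S_zb : lower_argmin f g xb = [set zb])
    (theta1_eq0 : theta ub (G xb yb) = set0)
    (theta2_eq0 : theta vb (g xb yb) = set0)
    (f_convex : @convex_function R 'rV[R]_m setT (f xb))
    (g_convex : forall j, @convex_function R 'rV[R]_m setT (component g j xb))
    (K_ucompact : uniformly_compact_near g xb)
    (K_neq0 : lower_feasible g xb !=set0)
    (lower_licq : LLICQ g xb yb)
    (lower_sosc : forall e : 'rV[R]_m, e != 0 ->
       (forall j, nu wb (g xb yb) j -> dot (grad (component g j xb) yb) e = 0) ->
       (forall j, theta wb (g xb yb) j -> dot (grad (component g j xb) yb) e <= 0) ->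
       0 < quad (hess (lower_lagrangian f g wb xb) yb) e)
    (upper_licq : ULICQ G g xb yb)
    (upper_sosc : forall (d1 : 'rV[R]_n) (d2 d3 : 'rV[R]_m),
       critical_cone G g xb yb ub vb wb (d1, d2, d3) ->
       (d1, d2, d3) <> (0, 0, 0) ->
       lam * quad (jhess (lower_lagrangian f g wb) xb yb) (row_mx d1 d3)
       < quad (jhess (lagrangian F f G g lam ub vb) xb yb) (row_mx d1 d2)) :
  strict_local_solution (upper_feasible G g) (penalized F f g lam) (xb, yb).
Proof.
have yb_min : lower_argmin f g xb yb by rewrite S_yb.
have : lower_argmin f g xb zb by rewrite S_zb.
rewrite S_yb => zbE.
move: zeta_stat; rewrite {}zbE => -[[st1 st2 st3] [compu compv compw]].
have dG i := C2_twice_differentiable (G_C2 i).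
have dg j := C2_twice_differentiable (g_C2 j).
have dL := twice_differentiable_lagrangian (C2_twice_differentiable F_C2)
  (C2_twice_differentiable f_C2) dG dg lam ub vb.
have dl := twice_differentiable_lower_lagrangian (C2_twice_differentiable f_C2) dg wb.
set L := lagrangian F f G g lam ub vb in st1 st2 upper_sosc dL.
set l := lower_lagrangian f g wb in st1 st3 upper_sosc dl.
(* Weighting each gradient by its multiplier leaves only the indices with positive multiplier, so
   the common kernel lies in the critical cone. *)
have [|c c0 growth] := @second_order_growth R n m ('I_p + 'I_q)%type 'I_q
  (jhess L xb yb) (jhess l xb yb) lam
  (fun i => match i with
    | inl i => ub 0 i *: jgrad (component G i) xb yb
    | inr j => vb 0 j *: jgrad (component g j) xb yb
    end) (fun j => wb 0 j *: jgrad (component g j) xb yb).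
  move=> d1 d2 d3 uv0 w0 d0; apply: upper_sosc => //; split=> i [ui _].
  - by have /eqP := uv0 (inl i); rewrite dotZl mulf_eq0 gt_eqF//= => /eqP.
  - by have /eqP := uv0 (inr i); rewrite dotZl mulf_eq0 gt_eqF//= => /eqP.
  - by have /eqP := w0 i; rewrite dotZl mulf_eq0 gt_eqF//= => /eqP.
pose K := `|ub| + `|vb| + `|wb|.
have K0 : 0 <= K by rewrite !addr_ge0.
(* In the total first-order error, [1 + lam] accounts for [Delta] and [K], which dominates every
   multiplier, for a weighted constraint; the sum is [c * t / 2]. *)
pose e1 := c / (2 * (1 + lam + K)).
have lamK0 : 0 < 1 + lam + K by rewrite ltr_wpDr// addr_gt0.
have e10 : 0 < e1 by rewrite divr_gt0// mulr_gt0.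
(* The second-order errors of the two Lagrangians then add up to [c * t ^+ 2 / 4], half of the lower
   bound for [2^-1 * Q] in the first alternative. *)
pose e2 := c / (4 * (1 + lam)).
have lam1 : 0 < 1 + lam by rewrite addr_gt0.
have e20 : 0 < e2 by rewrite divr_gt0// mulr_gt0.
have [r1 r10 L1] := joint_first_order_expansion xb yb dL e10.
have [r2 r20 l1] := joint_first_order_expansion xb yb dl e10.
have [r3 r30 L2] := joint_second_order_expansion xb yb dL e20.
have [r4 r40 l2] := joint_second_order_expansion xb yb dl e20.
have [r5 r50 G1] : exists2 r, 0 < r & forall i, forall x y t,
    `|x - xb| <= t -> `|y - yb| <= t -> t < r ->
    `|component G i x y - component G i xb yb
      - dot (jgrad (component G i) xb yb) (row_mx (x - xb) (y - yb))| <= e1 * t.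
  apply: uniform_radius => [i r r' rr' H x y t xt yt tr|i].
    by apply: H => //; exact: lt_le_trans rr'.
  exact: joint_first_order_expansion.
have [r6 r60 g1] : exists2 r, 0 < r & forall j, forall x y t,
    `|x - xb| <= t -> `|y - yb| <= t -> t < r ->
    `|component g j x y - component g j xb yb
      - dot (jgrad (component g j) xb yb) (row_mx (x - xb) (y - yb))| <= e1 * t.
  apply: uniform_radius => [j r r' rr' H x y t xt yt tr|j].
    by apply: H => //; exact: lt_le_trans rr'.
  exact: joint_first_order_expansion.
pose r := Num.min (Num.min (Num.min r1 r2) (Num.min r3 r4)) (Num.min r5 r6).
have r0 : 0 < r by rewrite !lt_min r10 r20 r30 r40 r50 r60.
have [delta delta0 zdelta] :=
  active_constraint_selection dg yb_min.1 lower_licq r0.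
split; first by split=> /=; [case: compu|case: compv].
apply/nbhs_ballP; exists (Num.min r delta) => /=; first by rewrite lt_min r0.
move=> [x y] [/=]; rewrite -!ball_normE/=.
rewrite distrC lt_min => /andP[xr /zdelta[z [zr zfea gz]]].
rewrite distrC lt_min => /andP[yr _] [/= Gxy gxy] xyn.
rewrite ltNge; apply/negP => xyle.
(* Either the multiplier is 0, or the constraint is active at [(xb, yb)] and [z] keeps it active. *)
have wgz j : wb 0 j * g x z 0 j = 0.
  have /eqP := complementary_mul0 j compw; rewrite mulf_eq0.
  by case/orP => /eqP => [->|/gz ->]; rewrite (mul0r, mulr0).
have bound := penalized_le_lagrangian (ltW lam_gt0) yb_min (S_neq0 x)
  compu compv compw zfea wgz xyle.
rewrite -/L -/l in bound.
pose d := row_mx (row_mx (x - xb) (y - yb)) (z - yb).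
pose t := `|d|.
have d12t : `|row_mx (x - xb) (y - yb)| <= t.
  by rewrite -[leLHS](congr1 Num.norm (row_mxKl _ (z - yb))) lsubmx_norm_le.
have xt : `|x - xb| <= t.
  apply: le_trans d12t.
  by rewrite -[leLHS](congr1 Num.norm (row_mxKl _ (y - yb))) lsubmx_norm_le.
have yt : `|y - yb| <= t.
  apply: le_trans d12t.
  by rewrite -[leLHS](congr1 Num.norm (row_mxKr (x - xb) _)) rsubmx_norm_le.
have zt : `|z - yb| <= t.
  rewrite -[leLHS](congr1 Num.norm (row_mxKr (row_mx (x - xb) (y - yb)) _)).
  exact: rsubmx_norm_le.
have t0 : 0 < t.
  rewrite normr_gt0; apply/eqP => d0; apply: xyn.
  move: xt yt; rewrite /t d0 normr0 !normr_le0 !subr_eq0.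
  by move=> /eqP -> /eqP ->.
have tr : t < r.
  apply: (@le_lt_trans _ _ (Num.max (Num.max `|x - xb| `|y - yb|) `|z - yb|)).
    apply: row_mx_norm_le; last by rewrite le_max lexx orbT.
    by apply: row_mx_norm_le; rewrite !le_max lexx ?orbT.
  by rewrite !gt_max xr yr zr.
move: tr; rewrite /r !lt_min.
move=> /andP[/andP[/andP[tr1 tr2] /andP[tr3 tr4]] /andP[tr5 tr6]].
(* The partial gradients in [y] and [z] vanish by stationarity, and those in [x] cancel. *)
have first0 : dot (jgrad L xb yb) (row_mx (x - xb) (y - yb))
    - lam * dot (jgrad l xb yb) (row_mx (x - xb) (z - yb)) = 0.
  rewrite !jgradE !dot_row_mx st2 st3 !dot0l !addr0 -dotZl -dotBl.
  by rewrite st1 dot0l.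
pose Q := quad (jhess L xb yb) (row_mx (x - xb) (y - yb))
    - lam * quad (jhess l xb yb) (row_mx (x - xb) (z - yb)).
have e2E : e2 * t ^+ 2 + lam * (e2 * t ^+ 2) = c * t ^+ 2 / 4.
  by rewrite /e2; field; rewrite gt_eqF.
have e1E : (1 + lam + K) * (e1 * t) = c * t / 2.
  by rewrite /e1; field; rewrite gt_eqF.
set Delta := L x y - L xb yb - lam * (l x z - l xb yb) in bound.
have lamle (s b : R) : `|s| <= b -> `|lam * s| <= lam * b.
  by move=> sb; rewrite normrM gtr0_norm// ler_pM2l.
have Delta2 : `|Delta - 2^-1 * Q| <= c * t ^+ 2 / 4.
  rewrite -e2E.
  have -> : Delta - 2^-1 * Q =
      (L x y - L xb yb - dot (jgrad L xb yb) (row_mx (x - xb) (y - yb))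
      - 2^-1 * quad (jhess L xb yb) (row_mx (x - xb) (y - yb)))
      - lam * (l x z - l xb yb - dot (jgrad l xb yb) (row_mx (x - xb) (z - yb))
      - 2^-1 * quad (jhess l xb yb) (row_mx (x - xb) (z - yb))).
    by rewrite /Q /Delta; move: first0; lra.
  rewrite (le_trans (ler_normB _ _))// lerD//; first exact: L2.
  by apply: lamle; exact: l2.
have Delta1 : `|Delta| <= e1 * t + lam * (e1 * t).
  have -> : Delta =
      (L x y - L xb yb - dot (jgrad L xb yb) (row_mx (x - xb) (y - yb)))
      - lam * (l x z - l xb yb - dot (jgrad l xb yb) (row_mx (x - xb) (z - yb))).
    by rewrite /Delta; move: first0; lra.
  rewrite (le_trans (ler_normB _ _))// lerD//; first exact: L1.
  by apply: lamle; exact: l1.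
have [u0 _ _] := compu; have [v0 _ _] := compv; have [w0 _ _] := compw.
have ct0 : 0 < c * t by rewrite mulr_gt0.
have ctt0 : 0 < c * t ^+ 2 by rewrite mulr_gt0// exprn_gt0.
have uG_le i := norm_term_le_oppr_dot i u0 Gxy.
have vg_le j := norm_term_le_oppr_dot j v0 gxy.
have dotuG : dot ub (G x y) <= 0.
  rewrite dotE sumr_le0// => i _; exact: mulr_ge0_le0.
have dotvg : dot vb (g x y) <= 0.
  rewrite dotE sumr_le0// => i _; exact: mulr_ge0_le0.
have Kt0 : 0 < e1 * t by rewrite mulr_gt0.
(* Here [a] and [b] are the new and old constraint values and [D] the linear term. By
   complementarity [A 0 j * b] vanishes, so the weighted linear term is at most [c * t / 2]. *)
have small k (a b D : R) (A : 'rV[R]_k) j : A 0 j * b = 0 -> `|A| <= K -> 0 <= A 0 j ->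
    `|A 0 j * a| <= e1 * t + lam * (e1 * t) -> `|a - b - D| <= e1 * t ->
    `|A 0 j * D| < c * t.
  move=> Ab AK A0 Aa abD.
  have -> : A 0 j * D = A 0 j * a - A 0 j * (a - b - D) - A 0 j * b by ring.
  rewrite Ab subr0 (le_lt_trans (ler_normB _ _))//.
  have AjK : A 0 j <= K.
    by rewrite (le_trans _ AK)// (le_trans _ (coord_norm_le A j))// ler_norm.
  have : `|A 0 j * (a - b - D)| <= K * (e1 * t) by rewrite normrM ger0_norm// ler_pM.
  by move: e1E Aa ct0; lra.
have := growth (x - xb) (y - yb) (z - yb); rewrite -/d -/t -/Q.
(* Under [cQ], [Delta] is at least [c * t ^+ 2 / 4], whereas [bound] makes it nonpositive. *)
move=> -[cQ|[[i|j]]|[j]]; first by move: Delta2; rewrite ler_norml; lra.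
- rewrite dotZl leNgt => /negP; apply.
  apply: (small _ _ _ _ ub i _ _ _ _ (G1 i _ _ _ xt yt tr5)) => //.
  + exact: complementary_mul0.
  + by rewrite /K -addrA lerDl addr_ge0.
  (* The weighted constraint value is at most [- dot ub (G x y)], hence at most [- Delta], because
     [dot vb (g x y)] is nonpositive. *)
  + move: Delta1; rewrite ler_norml; have := uG_le i; rewrite /component; lra.
- rewrite dotZl leNgt => /negP; apply.
  apply: (small _ _ _ _ vb j _ _ _ _ (g1 j _ _ _ xt yt tr6)) => //.
  + exact: complementary_mul0.
  + by rewrite /K addrAC lerDr addr_ge0.
  + move: Delta1; rewrite ler_norml; have := vg_le j; rewrite /component; lra.
- rewrite dotZl leNgt => /negP; apply.
  (* This case is expanded at [(x, z)], where the weighted constraint vanishes exactly. *)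
  apply: (small _ _ _ _ wb j _ _ _ _ (g1 j _ _ _ xt zt tr6)) => //.
  + exact: complementary_mul0.
  + by rewrite /K lerDr addr_ge0.
  + by rewrite /component wgz normr0; apply/ltW/addr_gt0 => //; exact: mulr_gt0.
Qed.
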